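(* The facet basis functions on the reference simplex $\widehat T$ defined in the context have $L^2$-orthogonal normal traces. In two dimensions, for every edge $F\subset\partial\widehat T$, $$(\phi^F_i\cdot n,\ \phi^F_j\cdot n)_F=c\,\delta_{ij}\qquad\forall\, i,j=0,\dots,k,$$ with $c=c(i,j)>0$. In three dimensions, for every face $F\subset\partial\widehat T$, $$(\phi^F_{ij}\cdot n,\ \phi^F_{lm}\cdot n)_F=c\,\delta_{il}\,\delta_{jm}\qquad\forall\, i,j,l,m\in\{0,\dots,k\}\ \text{with}\ i+j\le k,\ l+m\le k,$$ with $c=c(i,j,l,m)>0$.
   Context: $k\ge1$ is a fixed integer. $(\cdot,\cdot)_F$ is the $L^2(F)$ inner product and $n$ is the unit normal on $F$. **Reference simplex.** $\widehat T$ is the convex hull of $V_1=(-1,0),V_2=(1,0),V_3=(0,1)$ for $d=2$, and of $V_1=(-1,0,0),V_2=(1,0,0),V_3=(0,1,0),V_4=(0,0,1)$ for $d=3$. $\lambda_i$ are the barycentric coordinates, $\lambda_i(V_j)=\delta_{ij}$. In 2D the curl of a scalar is $\operatorname{curl}g=(\partial_yg,-\partial_xg)$. **Jacobi polynomials.** $p_n^\alpha(x)=\frac{1}{2^nn!(1-x)^\alpha}\frac{d^n}{dx^n}\big((1-x)^\alpha(x^2-1)^n\big)$ for $n\in\mathbb N_0$, $\alpha>-1$; integrated Jacobi polynomials $\hat p_n^\alpha(x)=\int_{-1}^xp_{n-1}^\alpha(\xi)\,d\xi$ for $n\ge1$, $\hat p_0^\alpha=1$. **2D facet functions.** For an edge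 $F=[f_1,f_2]\in\{[1,2],[2,3],[3,1]\}$ (from $V_{f_1}$ to $V_{f_2}$): the lowest-order Raviart–Thomas function $\phi_0^F=\operatorname{curl}(\lambda_{f_1})\lambda_{f_2}-\lambda_{f_1}\operatorname{curl}(\lambda_{f_2})$, and for $1\le i\le k$ $$\phi_i^F=\operatorname{curl}\Big(\hat p^0_{i+1}\big(\tfrac{\lambda_{f_2}-\lambda_{f_1}}{\lambda_{f_2}+\lambda_{f_1}}\big)(\lambda_{f_2}+\lambda_{f_1})^{i+1}\Big).$$ **3D facet functions.** For a face $F=[f_1,f_2,f_3]\in\{[1,2,3],[1,3,4],[1,2,4],[2,3,4]\}$ put $$u_i^F=\hat p_i^0\big(\tfrac{\lambda_{f_2}-\lambda_{f_1}}{\lambda_{f_2}+\lambda_{f_1}}\big)(\lambda_{f_2}+\lambda_{f_1})^i,\quad v_{ij}^F=\hat p_j^{2i-1}\big(\tfrac{\lambda_{f_3}-\lambda_{f_2}-\lambda_{f_1}}{\lambda_{f_3}+\lambda_{f_2}+\lambda_{f_1}}\big)(\lambda_{f_3}+\lambda_{f_2}+\lambda_{f_1})^j,\quad \mathcal N_0^{[f_1,f_2]}=\nabla\lambda_{f_1}\lambda_{f_2}-\lambda_{f_1}\nabla\lambda_{f_2}.$$ Then $\phi_{00}^F=\lambda_{f_1}\nabla\lambda_{f_2}\times\nabla\lambda_{f_3}+\lambda_{f_2}\nabla\lambda_{f_3}\times\nabla\lambda_{f_1}+\lambda_{f_3}\nabla\lambda_{f_1}\times\nabla\lambda_{f_2}$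 (lowest-order Raviart–Thomas); $\phi_{0l}^F=\nabla\times(\mathcal N_0^{[f_1,f_2]}v_{2l}^F)$ for $1\le l\le k$; $\phi_{ij}^F=\nabla\times\big(\nabla u^F_{i+1}\,v^F_{(i+1)(j+1)}\big)=-\nabla u^F_{i+1}\times\nabla v^F_{(i+1)(j+1)}$ for $i\ge1$, $j\ge0$, $i+j\le k$. (All these expressions are polynomials, extended continuously where denominators vanish.) *)

(* Defs.v *)
From HB Require Import structures.
From mathcomp Require Import all_boot all_order all_algebra.
From mathcomp Require Import all_classical all_reals all_analysis.
From mathcomp Require Import ring lra.
Set Implicit Arguments.
Unset Strict Implicit.
Unset Printing Implicit Defensive.
Import Order.TTheory GRing.Theory Num.Theory.
Import numFieldNormedType.Exports.
Local Open Scope classical_set_scope.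
Local Open Scope ring_scope.

Section Vectors.
Context {R : realType}.

Definition row2 (a b : R) : 'rV[R]_2 := \row_j nth 0 [:: a; b] j.
Definition row3 (a b c : R) : 'rV[R]_3 := \row_j nth 0 [:: a; b; c] j.

(* The library norm on 'rV[R]_d is the max norm, hence an explicit Euclidean
   structure. *)
Definition dot d (u v : 'rV[R]_d) : R := \sum_i u 0 i * v 0 i.
Definition enorm d (u : 'rV[R]_d) : R := Num.sqrt (dot u u).

Definition cross (u v : 'rV[R]_3) : 'rV[R]_3 :=
  row3 (u 0 1 * v 0 2 - u 0 2 * v 0 1)
       (u 0 2 * v 0 0 - u 0 0 * v 0 2)
       (u 0 0 * v 0 1 - u 0 1 * v 0 0).

End Vectors.

Section DifferentialOperators.
Context {R : realType}.

Definition partial d (i : 'I_d.+1) (f : 'rV[R]_d.+1 -> R) (x : 'rV[R]_d.+1) : R :=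
  'D_(delta_mx 0 i) f x.

Definition grad d (f : 'rV[R]_d.+1 -> R) (x : 'rV[R]_d.+1) : 'rV[R]_d.+1 :=
  \row_i partial i f x.

Definition curl2 (g : 'rV[R]_2 -> R) (x : 'rV[R]_2) : 'rV[R]_2 :=
  row2 (partial 1 g x) (- partial 0 g x).

Definition curl3 (f : 'rV[R]_3 -> 'rV[R]_3) (x : 'rV[R]_3) : 'rV[R]_3 :=
  let D i j := partial i (fun y => f y 0 j) x in
  row3 (D 1 2 - D 2 1) (D 2 0 - D 0 2) (D 0 1 - D 1 0).

End DifferentialOperators.

Section Jacobi.
Context {R : realType}.

(* Rodrigues' formula.  Only integer weights alpha occur in the basis functions.
   The division is an exact division of polynomials, see jacobiE. *)
Definition jacobi (n alpha : nat) : {poly R} :=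
  (2 ^ n * n`!)%:R^-1 *:
    (((1 - 'X) ^+ alpha * ('X^2 - 1) ^+ n)^`(n) %/ (1 - 'X) ^+ alpha).

Lemma dvdp_derivn_exp (q r : {poly R}) (m n : nat) :
  q ^+ m %| (q ^+ (m + n) * r)^`(n).
Proof.
elim: n m => [|n IHn] m; first by rewrite addn0 derivn0 dvdp_mulr.
have /dvdpP[s] := IHn m.+1; rewrite addSnnS derivnS => ->.
rewrite derivM deriv_exp dvdp_add ?dvdp_mull ?dvdp_exp2l//.
by rewrite -mulrnAl dvdp_mull.
Qed.

Lemma jacobiE (n alpha : nat) (x : R) : x != 1 ->
  (jacobi n alpha).[x] = (2 ^+ n * n`!%:R * (1 - x) ^+ alpha)^-1 *
    ((1 - 'X) ^+ alpha * ('X^2 - 1) ^+ n)^`(n).[x].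
Proof.
move=> x1; rewrite /jacobi hornerZ natrM natrX.
set p := _^`(n); set q := (1 - 'X) ^+ alpha.
have qp : q %| p.
  suff -> : p = ((1 - 'X) ^+ (alpha + n) * (- ('X + 1)) ^+ n)^`(n).
    exact: dvdp_derivn_exp.
  by rewrite /p exprD -mulrA -exprMn; congr ((_ * _ ^+ _)^`(n)); ring.
have qx : q.[x] = (1 - x) ^+ alpha by rewrite horner_exp !hornerE.
have nz : (1 - x) ^+ alpha != 0 by rewrite expf_neq0// subr_eq0 eq_sym.
rewrite -[in RHS](divpK qp) hornerM qx !invfM -!mulrA; do 2!congr (_ * _).
by rewrite mulrCA mulVf ?mulr1.
Qed.

(* The integral of p_(n-1) from -1 to x.  The second term vanishes for -1 <= x
   and gives the integral its orientation for x < -1. *)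
Definition int_jacobi (n alpha : nat) (x : R) : R :=
  if n is m.+1 then
    \int[lebesgue_measure]_(y in `[-1, x]) (jacobi m alpha).[y] -
    \int[lebesgue_measure]_(y in `[x, -1]) (jacobi m alpha).[y]
  else 1.

End Jacobi.

Section ContinuousExtension.
Context {R : realType}.

Definition cont_ext (T : topologicalType) (D : set T) (f : T -> R) (x : T) : R :=
  if x \in D then f x else lim (f @ within D (nbhs x)).

(* p(a/s) s^m, extended continuously to the zeros of s. *)
Definition scaled d (p : R -> R) (m : nat) (a s : 'rV[R]_d -> R) :
    'rV[R]_d -> R :=
  cont_ext [set x | s x != 0] (fun x => p (a x / s x) * s x ^+ m).

End ContinuousExtension.

(* The index i : 'I_(d.+1) stands for the vertex V_(i+1). *)
Section TwoD.
Context {R : realType}.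
Local Notation pt := 'rV[R]_2.

Definition vertex2 (i : 'I_3) : pt :=
  nth 0 [:: row2 (-1) 0; row2 1 0; row2 0 1] i.

Definition lambda2 (i : 'I_3) (x : pt) : R :=
  nth 0 [:: (1 - x 0 0 - x 0 1) / 2; (1 + x 0 0 - x 0 1) / 2; x 0 1] i.

Lemma lambda2_vertex (i j : 'I_3) : lambda2 i (vertex2 j) = (i == j)%:R.
Proof.
rewrite /lambda2 /vertex2.
case: i j => [[|[|[|[|//]]]] //= ?] [[|[|[|[|//]]]] //= ?];
  rewrite !mxE /=; lra.
Qed.

Definition edges : seq ('I_3 * 'I_3) := [:: (0, 1); (1, 2); (2, 0)].

Definition phi2 (F : 'I_3 * 'I_3) (i : nat) : pt -> pt :=
  let l1 := lambda2 F.1 in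
  let l2 := lambda2 F.2 in
  if i is 0%N then fun x => l2 x *: curl2 l1 x - l1 x *: curl2 l2 x
  else curl2 (scaled (int_jacobi i.+1 0) i.+1
                (fun x => l2 x - l1 x) (fun x => l2 x + l1 x)).

Definition unit_normal2 (F : 'I_3 * 'I_3) (n : pt) : Prop :=
  enorm n = 1 /\ dot n (vertex2 F.2 - vertex2 F.1) = 0.

(* The L^2(F) inner product, F being parametrized affinely over [0, 1]. *)
Definition L2_edge (F : 'I_3 * 'I_3) (g h : pt -> R) : R :=
  let A := vertex2 F.1 in
  let B := vertex2 F.2 in
  enorm (B - A) *
  \int[lebesgue_measure]_(t in `[0, 1])
    (g (A + t *: (B - A)) * h (A + t *: (B - A))).

End TwoD.

Section ThreeD.
Context {R : realType}.
Local Notation pt := 'rV[R]_3.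

Definition vertex3 (i : 'I_4) : pt :=
  nth 0 [:: row3 (-1) 0 0; row3 1 0 0; row3 0 1 0; row3 0 0 1] i.

Definition lambda3 (i : 'I_4) (x : pt) : R :=
  nth 0 [:: (1 - x 0 0 - x 0 1 - x 0 2) / 2; (1 + x 0 0 - x 0 1 - x 0 2) / 2;
            x 0 1; x 0 2] i.

Lemma lambda3_vertex (i j : 'I_4) : lambda3 i (vertex3 j) = (i == j)%:R.
Proof.
rewrite /lambda3 /vertex3.
case: i j => [[|[|[|[|//]]]] //= ?] [[|[|[|[|//]]]] //= ?];
  rewrite !mxE /=; lra.
Qed.

Definition faces : seq ('I_4 * 'I_4 * 'I_4) :=
  [:: (0, 1, 2); (0, 2, 3); (0, 1, 3); (1, 2, 3)].

Section FaceFunctions.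
Variable F : 'I_4 * 'I_4 * 'I_4.
Local Notation l1 := (lambda3 F.1.1).
Local Notation l2 := (lambda3 F.1.2).
Local Notation l3 := (lambda3 F.2).

Definition face_u (i : nat) : pt -> R :=
  scaled (int_jacobi i 0) i (fun x => l2 x - l1 x) (fun x => l2 x + l1 x).

(* Used with 1 <= i only. *)
Definition face_v (i j : nat) : pt -> R :=
  scaled (int_jacobi j (2 * i).-1) j
    (fun x => l3 x - l2 x - l1 x) (fun x => l3 x + l2 x + l1 x).

Definition nedelec0 (x : pt) : pt := l2 x *: grad l1 x - l1 x *: grad l2 x.

Definition phi3 (i j : nat) : pt -> pt :=
  match i, j with
  | 0%N, 0%N => fun x =>
      l1 x *: cross (grad l2 x) (grad l3 x) +
      l2 x *: cross (grad l3 x) (grad l1 x) +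
      l3 x *: cross (grad l1 x) (grad l2 x)
  | 0%N, l.+1 => curl3 (fun x => face_v 2 l.+1 x *: nedelec0 x)
  | i.+1, j => curl3 (fun x => face_v i.+2 j.+1 x *: grad (face_u i.+2) x)
  end.

End FaceFunctions.

Definition unit_normal3 (F : 'I_4 * 'I_4 * 'I_4) (n : pt) : Prop :=
  [/\ enorm n = 1, dot n (vertex3 F.1.2 - vertex3 F.1.1) = 0
    & dot n (vertex3 F.2 - vertex3 F.1.1) = 0].

(* The L^2(F) inner product, F being parametrized affinely over the triangle
   s, t >= 0, s + t <= 1. *)
Definition L2_face (F : 'I_4 * 'I_4 * 'I_4) (g h : pt -> R) : R :=
  let A := vertex3 F.1.1 in
  let B := vertex3 F.1.2 in
  let C := vertex3 F.2 in
  let P (z : R * R) := A + z.1 *: (B - A) + z.2 *: (C - A) in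
  enorm (cross (B - A) (C - A)) *
  \int[(lebesgue_measure \x lebesgue_measure)%E]_(z in
      [set z : R * R | [/\ 0 <= z.1, 0 <= z.2 & z.1 + z.2 <= 1]])
    (g (P z) * h (P z)).

End ThreeD.

(* Main.v *)
From HB Require Import structures.
Require Import Defs.
From mathcomp Require Import all_boot all_order all_algebra.
From mathcomp Require Import all_classical all_reals all_analysis.
From mathcomp Require Import measurable_realfun polyorder cauchyreals.
From mathcomp Require Import zify ring lra.
Set Implicit Arguments.
Unset Strict Implicit.
Unset Printing Implicit Defensive.
Import Order.TTheory GRing.Theory Num.Theory.
Import numFieldNormedType.Exports.
Local Open Scope classical_set_scope.
Local Open Scope ring_scope.

(* The normal component of a curl on a facet only involves tangential
   derivatives, so each normal trace can be computed in the parameters of the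
   facet.  In 2D, phi_i . n is a multiple of the Legendre polynomial
   p_i(2 t - 1).  In 3D, with parameters s = lambda_2, t = lambda_3,
     phi_ij . n = kappa (1 - t)^i p_i((2 s + t - 1) / (1 - t)) q_ij(2 t - 1)
   where q_ij is a multiple of the Jacobi polynomial p_j^(2 i + 1) for i >= 1,
   and q_0l(x) = (1 - x) p_(l-1)^3(x) - 2 \hat p_l^3(x) for l >= 1, so that
   (1 - x) q_0l = ((1 - x)^2 \hat p_l^3)'.  Integrating first in s gives the
   orthogonality of the Legendre polynomials and leaves, for equal first
   indices, the weight (1 - x)^(2 i + 1), for which (q_ij)_j is orthogonal; for
   i = 0 this follows by integrating by parts twice against powers of 1 - x. *)

(** * Formal antiderivatives of polynomials and integration over [-1, 1] *)

Section Antiderivative.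
Context {R : numFieldType}.
Implicit Types p q P Q : {poly R}.

(** At [i = 0] the coefficient is a quotient by 0, hence 0 by convention: this antiderivative
    vanishes at 0. *)
Definition primitive p : {poly R} :=
  \poly_(i < (size p).+1) (p`_i.-1 / i%:R).

Lemma deriv_primitive p : (primitive p)^`() = p.
Proof.
apply/polyP => i; rewrite coef_deriv coef_poly ltnS.
case: ltnP => ip; last by rewrite mul0rn nth_default.
by rewrite -[LHS]mulr_natr divfK// pnatr_eq0.
Qed.

Lemma horner_deriv_eq P Q x y :
  P^`() = Q^`() -> P.[y] - P.[x] = Q.[y] - Q.[x].
Proof.
move=> PQ; have : (size (P - Q)%R <= 1)%N.
  apply/leq_sizeP => -[//|j] _.
  have := congr1 (fun p : {poly R} => p`_j) PQ; rewrite !coef_deriv coefB.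
  move=> /eqP; rewrite -subr_eq0 -mulrnBl -mulr_natr mulf_eq0 pnatr_eq0 ?orbF.
  by move/eqP.
move=> /size1_polyC PQc.
by rewrite -[P](subrK Q) PQc !hornerD !hornerC opprD addrACA subrr add0r.
Qed.

(** The integral over [-1, 1] in algebraic form, so that linearity and integration by parts are
    formal; [Rintegral_homogp] and [Rintegral_weighted] tie it to Lebesgue integrals. *)
Definition defint p : R := (primitive p).[1] - (primitive p).[-1].

Lemma defint_deriv P : defint P^`() = P.[1] - P.[-1].
Proof. by apply: horner_deriv_eq; rewrite deriv_primitive. Qed.

Lemma defint_linear : linear defint.
Proof.
move=> a p q; rewrite -[p]deriv_primitive -[q]deriv_primitive.
rewrite -derivZ -derivD !defint_deriv !hornerD !hornerZ opprD addrACA.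
by congr (_ + _); rewrite -mulrBr.
Qed.

HB.instance Definition _ := GRing.isLinear.Build R {poly R} R _ defint
  defint_linear.

Lemma defintZ a p : defint (a *: p) = a * defint p.
Proof. exact: linearZ. Qed.

Lemma defint_by_parts P Q :
  defint (P^`() * Q) = (P * Q).[1] - (P * Q).[-1] - defint (P * Q^`()).
Proof. by rewrite -defint_deriv derivM raddfD addrK. Qed.

End Antiderivative.

(** The primitive is nondecreasing on [-1, 1]. Equal end values would make it constant there, hence
    everywhere as a polynomial, forcing [p = 0]. *)
Lemma defint_gt0 (R : realType) (p : {poly R}) :
  p != 0 -> (forall x : R, -1 <= x <= 1 -> 0 <= p.[x]) ->
  0 < defint p.
Proof.
move=> p0 pge0; set P := primitive p.
have Pmono (x y : R) : -1 <= x -> x <= y -> y <= 1 -> P.[x] <= P.[y].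
  move=> x1 xy y1.
  apply: (@ger0_derive1_le_cc R (horner P) (-1) 1) => //.
  - move=> z; rewrite in_itv/= => /andP[z1 z2].
    by rewrite -derivE deriv_primitive pge0// !ltW.
  - by apply: continuous_subspaceT; exact: continuous_horner.
  - by rewrite in_itv/= x1 (le_trans xy).
  - by rewrite in_itv/= y1 (le_trans x1).
rewrite subr_gt0 lt_neqAle Pmono ?lexx ?lerN1l// ?ler1N1// andbT.
apply/eqP => P11.
have Pc (x : R) : -1 <= x <= 1 -> P.[x] = P.[-1].
  by move=> /andP[x1 x2]; apply/eqP; rewrite eq_le {1}P11 !Pmono//.
move/eqP: p0; apply; rewrite -[p]deriv_primitive -/P.
rewrite -[P](subrK P.[-1]%:P) derivD derivC addr0.
set Q := P - _.
suff -> : Q = 0 by rewrite deriv0.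
(* The points [1 / (i + 1)] are distinct and lie in [-1, 1]; as many of them as the size of [Q] are
   too many roots. *)
apply: (@roots_geq_poly_eq0 _ _ [seq i.+1%:R^-1 : R | i <- iota 0 (size Q)]).
- apply/allP => _ /mapP[i _ ->]; rewrite /root hornerD hornerN hornerC Pc ?subrr//.
  rewrite (@le_trans _ _ 0) ?lerN10 ?invr_ge0//=.
  by rewrite invf_le1 ?ltr0n// ler1n.
- rewrite map_inj_uniq ?iota_uniq// => i j /invr_inj/eqP.
  by rewrite eqr_nat => /eqP[].
- by rewrite size_map size_iota.
Qed.

(** * Jacobi polynomials: degrees, orthogonality, positive norms *)

Section JacobiPolynomials.
Context {R : realType}.
Implicit Types (P q : {poly R}) (n alpha : nat).

(** Integrating by parts [n] times moves the derivatives onto [q], of degree below [n]; the boundary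
    terms contain lower derivatives of [P] at the endpoints. *)
Lemma defint_derivn_eq0 n P q : (size q <= n)%N ->
  (forall k, (k < n)%N -> P^`(k).[1] = 0 /\ P^`(k).[-1] = 0) ->
  defint (P^`(n) * q) = 0.
Proof.
elim: n q => [|n IHn] q qn P0.
  by move: qn; rewrite leqn0 size_poly_eq0 => /eqP ->; rewrite mulr0 raddf0.
have [P1 PN1] := P0 n (ltnSn n).
rewrite derivnS defint_by_parts !hornerM P1 PN1 !mul0r subrr sub0r.
rewrite IHn ?oppr0//; last by move=> k kn; apply: P0; rewrite ltnS ltnW.
have [->|q0] := eqVneq q 0; first by rewrite deriv0 size_poly0.
by rewrite -ltnS (leq_trans (lt_size_deriv q0)).
Qed.

(** A derivative lowers the multiplicity of a root by at most one, so a factor of exponent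
    [n - k > 0] survives. *)
Lemma horner_derivn_root (c : R) n k P : (k < n)%N ->
  ((('X - c%:P) ^+ n * P)^`(k)).[c] = 0.
Proof.
move=> kn; apply/eqP; rewrite -/(root _ _) root_factor_theorem.
apply: dvdp_trans (_ : ('X - c%:P) ^+ (n - k) %| _).
  by rewrite dvdp_exp// subn_gt0.
by rewrite -{2}(subnK (ltnW kn)) dvdp_derivn_exp.
Qed.

Lemma jacobi_weightE n alpha :
  (1 - 'X) ^+ alpha * jacobi n alpha =
  (2 ^ n * n`!)%:R^-1 *: ((1 - 'X) ^+ alpha * ('X^2 - 1) ^+ n)^`(n) :> {poly R}.
Proof.
rewrite /jacobi -scalerAr mulrC divpK//.
have -> : (1 - 'X) ^+ alpha * ('X^2 - 1) ^+ n =
          (1 - 'X) ^+ (alpha + n) * (- ('X + 1)) ^+ n :> {poly R}.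
  by rewrite exprD -mulrA -exprMn; congr (_ * _ ^+ _); ring.
exact: dvdp_derivn_exp.
Qed.

(** The polynomial differentiated in Rodrigues' formula has zeros of order at least [n] at both
    endpoints, so [defint_derivn_eq0] applies. *)
Lemma jacobi_orthogonal n alpha q : (size q <= n)%N ->
  defint ((1 - 'X) ^+ alpha * jacobi n alpha * q) = 0.
Proof.
move=> qn; rewrite jacobi_weightE -scalerAl linearZ/= defint_derivn_eq0 ?scaler0//.
move=> k kn; split.
  have -> : (1 - 'X) ^+ alpha * ('X^2 - 1) ^+ n =
      ('X - 1%:P) ^+ n * (('X + 1) ^+ n * (1 - 'X) ^+ alpha) :> {poly R}.
    by rewrite mulrA -exprMn [LHS]mulrC; congr (_ ^+ _ * _); ring.
  exact: horner_derivn_root.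
have -> : (1 - 'X) ^+ alpha * ('X^2 - 1) ^+ n =
    ('X - (-1)%:P) ^+ n * (('X - 1) ^+ n * (1 - 'X) ^+ alpha) :> {poly R}.
  by rewrite mulrA -exprMn [LHS]mulrC; congr (_ ^+ _ * _); ring.
exact: horner_derivn_root.
Qed.

Lemma size_expr P n : P != 0 -> size (P ^+ n) = ((size P).-1 * n).+1.
Proof.
by move=> P0; rewrite -size_exp prednK// size_poly_gt0 expf_neq0.
Qed.

Lemma size_1BX : size (1 - 'X : {poly R}) = 2%N.
Proof. by rewrite -opprB size_polyN size_XsubC. Qed.

Lemma size_1BX_exp n : size ((1 - 'X : {poly R}) ^+ n) = n.+1.
Proof. by rewrite size_expr ?size_1BX ?mul1n// -size_poly_eq0 size_1BX. Qed.

Lemma size_jacobi n alpha : size (jacobi n alpha : {poly R}) = n.+1.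
Proof.
have c0 : (2 ^ n * n`!)%:R^-1 != 0 :> R.
  by rewrite invr_eq0 pnatr_eq0 -lt0n muln_gt0 expn_gt0 fact_gt0.
have a0 : (1 - 'X) ^+ alpha != 0 :> {poly R}.
  by rewrite -size_poly_eq0 size_1BX_exp.
have sX : size ('X^2 - 1 : {poly R}) = 3%N by rewrite size_XnsubC.
have X0 : 'X^2 - 1 != 0 :> {poly R} by rewrite -size_poly_eq0 sX.
have := congr1 (fun p : {poly R} => size p) (jacobi_weightE n alpha).
rewrite size_scale// size_derivn [in RHS]size_mul ?(expf_neq0 n X0)//.
rewrite size_1BX_exp (size_expr n X0) sX/=.
have [->|j0] := eqVneq (jacobi n alpha : {poly R}) 0.
  by rewrite mulr0 size_poly0; lia.
by rewrite size_mul// size_1BX_exp/=; set s := size _; lia.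
Qed.

(* Normal traces of the facet functions with i = 0: here the weight in the
   orthogonality, [1], differs from [3], that of the polynomial integrated. *)
Lemma primitive_jacobi3_orthogonal n (v : {poly R}) q :
  v^`() = jacobi n 3 -> v.[-1] = 0 -> (size q <= n.+1)%N ->
  defint ((1 - 'X) * ((1 - 'X) * jacobi n 3 - 2%:P * v) * q) = 0.
Proof.
move=> v' v1 qn.
(* First integration by parts: [(1 - 'X) ^+ r.+2] is a derivative up to a constant, and what is left
   is [jacobi n 3] with its own weight, tested against [(1 - 'X) ^+ r]. *)
have v2 r : (r < n)%N -> defint ((1 - 'X) ^+ (r.+2) * v) = 0.
  move=> rn; have r3 : r.+3%:R != 0 :> R by rewrite pnatr_eq0.
  apply: (mulfI r3); rewrite mulr0 -[LHS]linearZ/=.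
  have -> : r.+3%:R *: ((1 - 'X) ^+ r.+2 * v) =
     ((- (1 - 'X) ^+ r.+3)^`() * v) :> {poly R}.
    rewrite derivN deriv_exp derivB derivX derivC.
    by rewrite sub0r mulN1r mulNrn opprK mulrnAl scaler_nat.
  have B1 : (- (1 - 'X) ^+ r.+3 * v).[1] = 0.
    by rewrite hornerM hornerN horner_exp !hornerE subrr expr0n/= oppr0 mul0r.
  have B2 : (- (1 - 'X) ^+ r.+3 * v).[-1] = 0 by rewrite hornerM v1 mulr0.
  rewrite defint_by_parts B1 B2 v' subrr sub0r mulNr raddfN opprK.
  rewrite (_ : (1 - 'X) ^+ r.+3 * jacobi n 3 =
             (1 - 'X) ^+ 3 * jacobi n 3 * (1 - 'X) ^+ r); last first.
    by rewrite [RHS]mulrAC -exprD.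
  apply: jacobi_orthogonal.
  by rewrite size_1BX_exp.
(* Second integration by parts: the factor in front of [(1 - 'X) ^+ r] is a derivative, which leads
   back to [v2] at [r - 1]; at [r = 0] nothing remains. *)
have basis r : (r <= n)%N ->
    defint ((1 - 'X) * ((1 - 'X) * jacobi n 3 - 2%:P * v) * (1 - 'X) ^+ r) = 0.
  move=> rn.
  have -> : (1 - 'X) * ((1 - 'X) * jacobi n 3 - 2%:P * v) =
            ((1 - 'X) ^+ 2 * v)^`() :> {poly R}.
    rewrite derivM deriv_exp derivB derivX derivC v' polyCMn polyC1/=.
    by rewrite -mulr_natr expr1; ring.
  have B1 : ((1 - 'X) ^+ 2 * v * (1 - 'X) ^+ r).[1] = 0.
    by rewrite 2!hornerM horner_exp !hornerE subrr expr0n/= !mul0r.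
  have B2 : ((1 - 'X) ^+ 2 * v * (1 - 'X) ^+ r).[-1] = 0.
    by rewrite 2!hornerM v1 mulr0 mul0r.
  rewrite defint_by_parts B1 B2 subrr sub0r.
  case: r rn {B1 B2} => [|r] rn; first by rewrite expr0 derivC mulr0 raddf0 oppr0.
  rewrite (_ : _ * _ = - r.+1%:R *: ((1 - 'X) ^+ r.+2 * v)).
    by rewrite linearZ/= v2// scaler0 oppr0.
  rewrite deriv_exp derivB derivX derivC sub0r mulN1r/= mulNrn mulrN scaleNr.
  by rewrite scaler_nat mulrnAr mulrAC -exprD.
(* The map [x |-> 1 - x] is an involution, so the coefficients of [q] in powers of [1 - 'X] are
   those of [q \Po (1 - 'X)]. *)
have -> : q = \sum_(r < size (q \Po (1 - 'X)))
                (q \Po (1 - 'X))`_r *: (1 - 'X) ^+ r.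
  rewrite -comp_polyE -comp_polyA comp_polyB comp_polyC comp_polyX subKr.
  by rewrite comp_polyXr.
rewrite mulr_sumr raddf_sum big1// => r _.
rewrite -scalerAr /= linearZ/= basis ?scaler0// -ltnS (leq_trans (ltn_ord r))//.
by rewrite size_comp_poly2 ?size_1BX.
Qed.

Lemma jacobi00 : jacobi 0 0 = 1 :> {poly R}.
Proof. by rewrite /jacobi !expr0 mul1r derivn0 divp1 invr1 scale1r. Qed.

(** The polynomial form of [int_jacobi]; the values agree by [int_jacobiE]. *)
Definition int_jacobip n alpha : {poly R} :=
  if n is m.+1 then
    primitive (jacobi m alpha) - (primitive (jacobi m alpha)).[-1]%:P
  else 1.

Lemma deriv_int_jacobip n alpha : (int_jacobip n.+1 alpha)^`() = jacobi n alpha.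
Proof. by rewrite derivB derivC subr0 deriv_primitive. Qed.

Lemma int_jacobip_N1 n alpha : (int_jacobip n.+1 alpha).[-1] = 0.
Proof. by rewrite hornerD hornerN hornerC subrr. Qed.

Lemma size_int_jacobip n alpha : size (int_jacobip n alpha) = n.+1.
Proof.
case: n => [|n]; first by rewrite size_poly1.
have := size_deriv (int_jacobip n.+1 alpha).
by rewrite deriv_int_jacobip size_jacobi; case: (size _) => //= s ->.
Qed.

(* The second factor of the normal trace of phi_ij, a function of
   x = 2 lambda_3 - 1 only; see trace_face. *)
Definition face_poly i j : {poly R} :=
  match i, j with
  | 0%N, 0%N => 1
  | 0%N, l.+1 => (1 - 'X) * jacobi l 3 - 2%:P * int_jacobip l.+1 3
  | _, _ => - 4%:P * jacobi j (2 * i).+1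
  end.

(** For [i >= 1] the weight exponent is the Jacobi parameter in [face_poly]; [i = 0] is the case of
    mixed weights. For [j = 0], [q] is zero. *)
Lemma face_poly_orthogonal i j q : (size q <= j)%N ->
  defint ((1 - 'X) ^+ (2 * i).+1 * face_poly i j * q) = 0.
Proof.
case: i j => [|i] [|j] qj.
- by move: qj; rewrite leqn0 size_poly_eq0 => /eqP ->; rewrite mulr0 raddf0.
- by rewrite expr1 primitive_jacobi3_orthogonal ?deriv_int_jacobip// ?int_jacobip_N1.
- by move: qj; rewrite leqn0 size_poly_eq0 => /eqP ->; rewrite mulr0 raddf0.
- rewrite /face_poly mulrCA -mulrA mulNr mul_polyC raddfN/= linearZ/=.
  by rewrite jacobi_orthogonal// scaler0 oppr0.
Qed.

Lemma size_face_poly i j : size (face_poly i j) = j.+1.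
Proof.
have n0 k : k.+1%:R != 0 :> R by rewrite pnatr_eq0.
case: i j => [|i] [|j]; rewrite /face_poly ?size_poly1//; last 2 first.
- by rewrite mulNr size_polyN size_Cmul ?n0// size_jacobi.
- by rewrite mulNr size_polyN size_Cmul ?n0// size_jacobi.
set v := int_jacobip _ _; have sv : size v = j.+2 by exact: size_int_jacobip.
apply/eqP; rewrite eqn_leq; apply/andP; split.
  rewrite (leq_trans (size_polyD _ _))// geq_max size_polyN size_Cmul ?n0// sv.
  by rewrite leqnn andbT (leq_trans (size_polyMleq _ _))// size_1BX size_jacobi.
(* No cancellation at the top: since [v' = jacobi j 3], the coefficient of degree [j + 1] in
   [(1 - 'X) v' - 2 v] is [-(j + 3)] times the leading coefficient of [v]. *)
rewrite ltnNge; apply/negP => /leq_sizeP/(_ j.+1 (leqnn _)).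
rewrite -(deriv_int_jacobip j 3) -/v mulrBl mul1r !coefB coefCM coefXM/=.
rewrite !coef_deriv [v`_j.+2]nth_default ?sv// mul0rn sub0r.
rewrite -[v`_ _ *+ _]mulr_natl -opprD -mulrDl -natrD => /eqP.
rewrite oppr_eq0 mulf_eq0 addnS (negbTE (n0 _))/=.
by apply/negP; rewrite -[j.+1]/(j.+2.-1) -sv -lead_coefE lead_coef_eq0
           -size_poly_eq0 sv.
Qed.

Lemma defint_sqr_gt0 n q : q != 0 -> 0 < defint ((1 - 'X) ^+ n * q * q).
Proof.
move=> p0; apply: defint_gt0.
  by rewrite !mulf_neq0// -size_poly_eq0 size_1BX_exp.
move=> x /andP[_ x1]; have w0 : 0 <= (1 - x) ^+ n by rewrite exprn_ge0 ?subr_ge0.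
rewrite -mulrA !hornerM horner_exp hornerD hornerN hornerC hornerX.
by rewrite mulr_ge0// -expr2 sqr_ge0.
Qed.

(** The integrand is symmetric in the two factors, so the one of lower degree can serve as test
    polynomial. *)
Lemma defint_orthogonal n (f : nat -> {poly R}) :
  (forall j, size (f j) = j.+1) ->
  (forall j q, (size q <= j)%N -> defint ((1 - 'X) ^+ n * f j * q) = 0) ->
  forall j m, exists2 c, 0 < c &
    defint ((1 - 'X) ^+ n * f j * f m) = c * (j == m)%:R.
Proof.
move=> sf f0 j m; have [<-|jm] := eqVneq j m.
  exists (defint ((1 - 'X) ^+ n * f j * f j)); last by rewrite mulr1.
  by rewrite defint_sqr_gt0// -size_poly_eq0 sf.
(* Both sides vanish, so the positive constant is arbitrary. *)
exists 1 => //; rewrite mulr0.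
have [ltjm|ltmj|/eqP] := ltngtP j m; last by rewrite (negbTE jm).
  by rewrite mulrAC f0 ?sf.
by rewrite f0 ?sf.
Qed.

Lemma legendre_orthogonal i l : exists2 c : R, 0 < c &
  defint (jacobi i 0 * jacobi l 0) = c * (i == l)%:R.
Proof.
have [j q qj|c c0 E] := @defint_orthogonal 0 (fun j => jacobi j 0)
  (fun j => size_jacobi j 0) _ i l; first exact: jacobi_orthogonal.
by exists c => //; rewrite -E mul1r.
Qed.

Lemma face_poly_norm i j m : exists2 c : R, 0 < c &
  defint ((1 - 'X) ^+ (2 * i).+1 * face_poly i j * face_poly i m) =
  c * (j == m)%:R.
Proof.
exact: (defint_orthogonal (size_face_poly i) (@face_poly_orthogonal i)).
Qed.

End JacobiPolynomials.

(** * Lebesgue integrals of polynomials over segments *)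

Section PolynomialIntegrals.
Context {R : realType}.
Implicit Types P Q : {poly R}.

Lemma Rintegral_deriv P (a b : R) : a <= b ->
  \int[lebesgue_measure]_(y in `[a, b]) P^`().[y] = P.[b] - P.[a].
Proof.
rewrite le_eqVlt => /predU1P[<-|ab]; first by rewrite set_itv1 Rintegral_set1 subrr.
rewrite /Rintegral (@continuous_FTC2 R _ (horner P))//.
- by apply: continuous_subspaceT; exact: continuous_horner.
- split => [x _||]; first exact: derivable_horner.
  + by apply: cvg_at_right_filter; exact: continuous_horner.
  + by apply: cvg_at_left_filter; exact: continuous_horner.
- by move=> x _; rewrite -derivE.
Qed.

Lemma int_jacobiE n alpha (x : R) :
  int_jacobi n alpha x = (int_jacobip n alpha).[x].
Proof.
case: n => [|n]; first by rewrite /= hornerC.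
rewrite /int_jacobi -(deriv_int_jacobip n alpha).
set P := int_jacobip _ _; have P1 : P.[-1] = 0 by exact: int_jacobip_N1.
(* Below -1 the first integral is over an empty interval and the second carries the sign; from -1 on
   the second is over a point or an empty interval. *)
have [x1|x1] := ltP x (-1).
- rewrite set_itv_ge ?bnd_simp -?ltNge// /Rintegral integral_set0/= sub0r.
  by rewrite -/(Rintegral _ _ _) Rintegral_deriv ?ltW// P1 sub0r opprK.
- rewrite Rintegral_deriv// P1 subr0.
  move: x1; rewrite le_eqVlt => /predU1P[<-|x1].
    by rewrite set_itv1 Rintegral_set1 subr0.
  by rewrite set_itv_ge ?bnd_simp -?ltNge// /Rintegral integral_set0 subr0.
Qed.

End PolynomialIntegrals.

(** * Homogenization of one-variable polynomials *)

Section Homogenization.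
Context {R : fieldType}.
Implicit Types P Q : {poly R}.

(* [(homogp m P s).[a]] is [P (a / s) * s ^+ m] extended to s = 0. *)
Definition homogp m P (s : R) : {poly R} :=
  \poly_(r < m.+1) (P`_r * s ^+ (m - r)).

(** All terms have total degree [m] in the argument and [s]; stated without division, the identity
    also covers [s = 0]. *)
Lemma horner_homogp_scale m P c s : (size P <= m.+1)%N ->
  (homogp m P s).[c * s] = P.[c] * s ^+ m.
Proof.
move=> Pm; rewrite horner_poly (horner_coef_wide c Pm) mulr_suml.
apply: eq_bigr => r _; rewrite exprMn mulrACA -exprD subnK -1?ltnS//.
Qed.

Lemma horner_homogp m P a s : s != 0 -> (size P <= m.+1)%N ->
  (homogp m P s).[a] = P.[a / s] * s ^+ m.
Proof. by move=> s0 Pm; rewrite -horner_homogp_scale// divfK. Qed.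

Lemma homogpZ m a P s : homogp m (a *: P) s = a *: homogp m P s.
Proof.
apply/polyP => r; rewrite coefZ !coef_poly coefZ.
by case: ifP; rewrite ?mulr0// mulrA.
Qed.

Lemma deriv_homogp m P s : (homogp m.+1 P s)^`() = homogp m P^`() s.
Proof.
apply/polyP => r; rewrite coef_deriv 2!coef_poly ltnS subSS coef_deriv.
by case: ifP => _; rewrite ?mul0rn// mulrnAl.
Qed.

Lemma homogp_1 m P : (size P <= m.+1)%N -> homogp m P 1 = P.
Proof.
move=> Pm; apply/polyP => r; rewrite coef_poly expr1n mulr1.
by case: ltnP => // mr; rewrite nth_default// (leq_trans Pm).
Qed.

End Homogenization.

(** * Integrals over a slice of the triangle and over its height *)

Section ReferenceIntegrals.
Context {R : realType}.
Local Notation mu := (@lebesgue_measure R).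
Implicit Types (P p q : {poly R}) (w : R).

(** The substitution [x = 2 s - w] maps [0, w] onto [-w, w] and gives the factor 1/2. *)
Lemma Rintegral_symmetrized P w : 0 <= w ->
  \int[mu]_(s in `[0, w]) P^`().[2 * s - w] = (P.[w] - P.[- w]) / 2.
Proof.
move=> w0; pose Q := 2^-1 *: (P \Po (2%:P * 'X - w%:P)).
rewrite (@eq_Rintegral _ _ _ mu _ (fun s => Q^`().[s])).
  rewrite Rintegral_deriv// /Q !hornerZ !horner_comp !hornerE.
  by rewrite mulr2n mulrDl mul1r addrK -mulrBr mulrC.
move=> s _; rewrite /Q derivZ deriv_comp derivB derivC subr0 derivM derivC.
rewrite derivX mul0r add0r mulr1 hornerZ hornerM horner_comp.
by rewrite hornerD hornerN hornerM !hornerC hornerX; field.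
Qed.

(** The integrand is homogeneous of degree [i + l] in [2 s - w] and [w], and the interval adds one
    power of [w]; the homogenized primitive of [p * q] is the antiderivative. *)
Lemma Rintegral_homogp i l p q w : 0 <= w ->
  (size p <= i.+1)%N -> (size q <= l.+1)%N ->
  \int[mu]_(s in `[0, w])
     ((homogp i p w).[2 * s - w] * (homogp l q w).[2 * s - w]) =
  w ^+ (i + l).+1 * (defint (p * q) / 2).
Proof.
rewrite le_eqVlt => /predU1P[<- _ _|w0 pi ql].
  by rewrite set_itv1 Rintegral_set1 expr0n/= mul0r.
have w1 := lt0r_neq0 w0.
have pq : (size (p * q)%R <= (i + l).+1)%N.
  by rewrite (leq_trans (size_polyMleq _ _))//; lia.
have Kpq : (size (primitive (p * q)) <= (i + l).+2)%N.
  by rewrite (leq_trans (size_poly _ _)).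
rewrite (@eq_Rintegral _ _ _ mu _
  (fun s => (homogp (i + l).+1 (primitive (p * q)) w)^`().[2 * s - w])).
  have := horner_homogp_scale (-1) w Kpq; have := horner_homogp_scale 1 w Kpq.
  rewrite mul1r mulN1r Rintegral_symmetrized ?ltW// => -> ->.
  by rewrite /defint; ring.
move=> s _; rewrite deriv_homogp deriv_primitive !horner_homogp//.
by rewrite hornerM exprD; ring.
Qed.

(** With [x = 2 t - 1], [1 - t = (1 - x) / 2] and [dt = dx / 2], whence the [n + 1] factors 2. *)
Lemma Rintegral_weighted n p :
  \int[mu]_(t in `[0, 1]) ((1 - t) ^+ n * p.[2 * t - 1]) =
  defint ((1 - 'X) ^+ n * p) / 2 ^+ n.+1.
Proof.
pose P := (2 ^+ n)^-1 *: primitive ((1 - 'X) ^+ n * p).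
rewrite (@eq_Rintegral _ _ _ mu _ (fun t => P^`().[2 * t - 1])).
  rewrite Rintegral_symmetrized// /P !hornerZ -mulrBr exprS invfM -/(defint _).
  by ring.
move=> t _; rewrite derivZ deriv_primitive hornerZ hornerM horner_exp.
rewrite hornerD hornerN hornerC hornerX mulrA -exprVn -exprMn.
by congr (_ ^+ _ * _); field.
Qed.

End ReferenceIntegrals.

(** * Fubini's theorem on the parameter triangle *)

Section Triangle.
Context {R : realType}.
Local Notation mu := (@lebesgue_measure R).

Definition triangle : set (R * R) :=
  [set z | [/\ 0 <= z.1, 0 <= z.2 & z.1 + z.2 <= 1]].

Lemma measurable_triangle : measurable triangle.
Proof.
have -> : triangle = (fst @^-1` `[0, +oo[) `&` (snd @^-1` `[0, +oo[) `&`
    ((fun z : R * R => z.1 + z.2) @^-1` `]-oo, 1]).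
  apply/seteqP; split => z /=; rewrite !in_itv/= !andbT.
    by case=> *; split => //; split.
  by case=> -[].
apply: measurableI; first apply: measurableI.
- rewrite -[X in measurable X]setTI; exact: measurable_fst.
- rewrite -[X in measurable X]setTI; exact: measurable_snd.
- rewrite -[X in measurable X]setTI.
  exact: measurable_funD.
Qed.

Lemma Rintegral_triangle (f : R * R -> R) :
  continuous f -> measurable_fun setT f ->
  \int[(mu \x mu)%E]_(z in triangle) f z =
  \int[mu]_(t in `[0, 1]) \int[mu]_(s in `[0, 1 - t]) f (s, t).
Proof.
move=> cf mf.
have mT := measurable_triangle.
(* The unit square contains the triangle, has finite measure and is compact, so a continuous [f] is
   bounded on it. *)
have fint : ((mu \x mu)%E).-integrable triangle (EFin \o f).
  apply: measurable_bounded_integrable => //.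
  - have sub : triangle `<=` `[0, 1] `*` `[0, 1].
      move=> z [z1 z2 z12]; split; rewrite /= in_itv/=; lra.
    apply: (@le_lt_trans _ _ ((mu \x mu)%E (`[0%R, 1%R] `*` `[0%R, 1%R]))).
      by apply: le_measure => //; rewrite inE//; exact: measurableX.
    rewrite product_measure1E//= lebesgue_measure_itv/= lte_fin ltr01.
    by rewrite -EFinD -EFinM ltry.
  - exact: measurable_funS mf.
  - have : compact (`[0 : R, 1] `*` `[0 : R, 1]).
      by apply: compact_setX; exact: segment_compact.
    move=> /(continuous_compact (continuous_subspaceT cf))/compact_bounded[M [_ mrt]].
    exists M; split; rewrite ?num_real // => y My z [z1 z2 z12]; apply: mrt => //.
    exists z => //; split; rewrite /= in_itv/=; lra.
rewrite /Rintegral integral_mkcond -integral21_prod_meas1; last first.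
  exact/(@integrable_mkcond _ _ _ (mu \x mu)%E triangle (EFin \o f) mT).
rewrite [in RHS]integral_mkcond; congr fine; apply: eq_integral => t _.
rewrite /fubini_G !patchE; case: ifPn => [|]; rewrite ?inE ?notin_setE/= in_itv/=.
- move=> /andP[t0 t1].
  (* The slice integral of a continuous function over a segment is finite, so [fine] loses
     nothing. *)
  rewrite fineK; last first.
    apply: integrable_fin_num => //; apply: continuous_compact_integrable.
      exact: segment_compact.
    apply: continuous_subspaceT => s.
    have ct : {for s, continuous (fun s : R => (s, t : R))}.
      by apply: (@cvg_pair _ _ _ _ (nbhs s) (nbhs t));
        [exact: cvg_id|exact: cvg_cst].
    exact: (continuous_comp ct (cf _)).
  rewrite [RHS]integral_mkcond; apply: eq_integral => s _; rewrite !patchE.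
  congr (if _ then _ else _); apply/idP/idP; rewrite !inE/= in_itv/=.
    by move=> [/= s0 _ st]; rewrite s0/=; lra.
  by move=> /andP[s0 st]; split => //=; lra.
- move=> tn; rewrite integral0_eq// => s _; rewrite patchE ifN// notin_setE.
  by move=> [/= *]; apply: tn; lra.
Qed.

End Triangle.

(** * Polynomial functions of several variables and their directional derivatives *)

Section PolynomialFunctions.
Context {R : realType} {d : nat}.
Local Notation V := 'rV[R]_d.+1.

(** Generating the class by ring operations lets differentiability, closure under derivatives and
    symmetry of second derivatives go by induction. *)
Inductive polyfun : (V -> R) -> Prop :=
| polyfun_cst c : polyfun (fun=> c)
| polyfun_coord i : polyfun (fun x => x 0 i)
| polyfunD f g : polyfun f -> polyfun g -> polyfun (fun x => f x + g x)
| polyfunM f g : polyfun f -> polyfun g -> polyfun (fun x => f x * g x).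

Lemma polyfunZ c f : polyfun f -> polyfun (fun x => c * f x).
Proof. by move=> pf; apply: polyfunM => //; exact: polyfun_cst. Qed.

Lemma polyfunB f g : polyfun f -> polyfun g -> polyfun (fun x => f x - g x).
Proof.
move=> pf pg; have -> : (fun x => f x - g x) = (fun x => f x + -1 * g x).
  by apply/funext => x; rewrite mulN1r.
by apply: polyfunD => //; exact: polyfunZ.
Qed.

Lemma polyfunX f n : polyfun f -> polyfun (fun x => f x ^+ n).
Proof.
move=> pf; elim: n => [|n IHn]; first exact: polyfun_cst.
have -> : (fun x => f x ^+ n.+1) = (fun x => f x * f x ^+ n).
  by apply/funext => x; rewrite exprS.
exact: polyfunM.
Qed.

Lemma polyfun_sum n (f : 'I_n -> V -> R) :
  (forall i, polyfun (f i)) -> polyfun (fun x => \sum_i f i x).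
Proof.
elim: n f => [|n IHn] f pf.
  have -> : (fun x => \sum_i f i x) = (fun=> 0).
    by apply/funext => x; rewrite big_ord0.
  exact: polyfun_cst.
have -> : (fun x => \sum_i f i x) =
          (fun x => f ord0 x + \sum_(i < n) f (lift ord0 i) x).
  by apply/funext => x; rewrite big_ord_recl.
by apply: polyfunD => //; apply: IHn.
Qed.

Lemma polyfun_homogp m (P : {poly R}) (a s : V -> R) :
  polyfun a -> polyfun s -> polyfun (fun x => (homogp m P (s x)).[a x]).
Proof.
move=> pa ps.
have -> : (fun x => (homogp m P (s x)).[a x]) =
    (fun x => \sum_(r < m.+1) P`_r * s x ^+ (m - r) * a x ^+ r).
  by apply/funext => x; rewrite horner_poly.
apply: polyfun_sum => r; apply: polyfunM; last exact: polyfunX.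
by apply: polyfunZ; exact: polyfunX.
Qed.

Lemma polyfun_differentiable f x : polyfun f -> differentiable f x.
Proof.
elim=> [c|i|g h _ dg _ dh|g h _ dg _ dh].
- exact: differentiable_cst.
- exact: differentiable_coord.
- exact: differentiableD.
- exact: differentiableM.
Qed.

Lemma polyfun_derivable f x w : polyfun f -> derivable f x w.
Proof. by move=> pf; apply: diff_derivable; exact: polyfun_differentiable. Qed.

Lemma derive_polyfunD f g x w : polyfun f -> polyfun g ->
  'D_w (fun y => f y + g y) x = 'D_w f x + 'D_w g x.
Proof. by move=> pf pg; apply: deriveD; exact: polyfun_derivable. Qed.

Lemma derive_polyfunM f g x w : polyfun f -> polyfun g ->
  'D_w (fun y => f y * g y) x = f x * 'D_w g x + g x * 'D_w f x.
Proof. by move=> pf pg; apply: deriveM; exact: polyfun_derivable. Qed.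

Lemma derive_coord i x (w : V) : 'D_w (fun y : V => y 0 i) x = w 0 i.
Proof.
rewrite /derive; apply/cvg_lim => //=; apply: cvg_near_cst.
near=> h; rewrite /= !mxE addrK /GRing.scale/= mulKf//.
by near: h; exact: nbhs_dnbhs_neq.
Unshelve. all: by end_near. Qed.

Lemma polyfun_derive f w : polyfun f -> polyfun ('D_w f).
Proof.
elim=> [c|i|g h pg dg ph dh|g h pg dg ph dh].
- rewrite (_ : 'D_w _ = fun=> 0); first exact: polyfun_cst.
  by apply/funext => x; rewrite derive_cst.
- rewrite (_ : 'D_w _ = fun=> w 0 i); first exact: polyfun_cst.
  by apply/funext => x; rewrite derive_coord.
- rewrite (_ : 'D_w _ = fun x => 'D_w g x + 'D_w h x); first exact: polyfunD.
  by apply/funext => x; rewrite derive_polyfunD.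
- rewrite (_ : 'D_w _ = fun x => g x * 'D_w h x + h x * 'D_w g x).
    by apply: polyfunD; exact: polyfunM.
  by apply/funext => x; rewrite derive_polyfunM.
Qed.

Lemma derive_comm f v w x : polyfun f ->
  'D_v ('D_w f) x = 'D_w ('D_v f) x.
Proof.
have D_ext (u : V) (g h : V -> R) : g =1 h -> 'D_u g x = 'D_u h x.
  by move=> /funext ->.
elim=> [c|i|g h pg dg ph dh|g h pg dg ph dh].
- have Dc (u : V) : 'D_u (fun=> c) =1 cst 0 by move=> y; exact: (derive_cst c).
  by rewrite (D_ext _ _ _ (Dc v)) (D_ext _ _ _ (Dc w)) !derive_cst.
- have Dc (u : V) : 'D_u (fun y : V => y 0 i) =1 cst (u 0 i).
    by move=> y; exact: derive_coord.
  by rewrite (D_ext _ _ _ (Dc v)) (D_ext _ _ _ (Dc w)) !derive_cst.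
- have DD u : 'D_u (fun y => g y + h y) =1 (fun y => 'D_u g y + 'D_u h y).
    by move=> y; exact: derive_polyfunD.
  rewrite (D_ext _ _ _ (DD v)) (D_ext _ _ _ (DD w)).
  have pD u : polyfun ('D_u g) /\ polyfun ('D_u h).
    by split; exact: polyfun_derive.
  have [pvg pvh] := pD v; have [pwg pwh] := pD w.
  by rewrite (derive_polyfunD x v pwg pwh) (derive_polyfunD x w pvg pvh) dg dh.
- have DM u : 'D_u (fun y => g y * h y) =1
      (fun y => g y * 'D_u h y + h y * 'D_u g y).
    by move=> y; exact: derive_polyfunM.
  have pD u : polyfun ('D_u g) /\ polyfun ('D_u h).
    by split; exact: polyfun_derive.
  have [pvg pvh] := pD v; have [pwg pwh] := pD w.
  rewrite (D_ext _ _ _ (DM v)) (D_ext _ _ _ (DM w)).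
  rewrite (derive_polyfunD x v (polyfunM pg pwh) (polyfunM ph pwg)).
  rewrite (derive_polyfunD x w (polyfunM pg pvh) (polyfunM ph pvg)).
  rewrite (derive_polyfunM x v pg pwh) (derive_polyfunM x v ph pwg).
  rewrite (derive_polyfunM x w pg pvh) (derive_polyfunM x w ph pvg).
  by rewrite dg dh; ring.
Qed.

Lemma dot_grad f x w : polyfun f -> dot (grad f x) w = 'D_w f x.
Proof.
move=> pf; have df := polyfun_differentiable x pf.
rewrite deriveE// [in RHS](row_sum_delta w) raddf_sum; apply: eq_bigr => i _.
by rewrite /= linearZ/= /grad mxE /partial deriveE// mulrC.
Qed.

(** The two difference quotients coincide. Tangential derivatives on a facet thus become derivatives
    of polynomials in one variable. *)
Lemma derive_line (f : V -> R) (P : {poly R}) (x w : V) :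
  (forall h, f (h *: w + x) = P.[h]) -> 'D_w f x = P^`().[0].
Proof.
move=> fP; rewrite derivE derive1E /derive.
rewrite (_ : (fun h => h^-1 *: ((f \o shift x) (h *: w) - f x)) =
  (fun h => h^-1 *: ((horner P \o shift 0) (h *: 1) - P.[0])))//.
apply/funext => h /=; have := fP 0; rewrite scale0r add0r => ->.
by rewrite fP addr0 [h *: 1]mulr1.
Qed.

Lemma polyfun_dotl (f : V -> V) (c : V) :
  (forall j, polyfun (fun x => f x 0 j)) -> polyfun (fun x => dot (f x) c).
Proof.
move=> pf; apply: polyfun_sum => j.
by apply: polyfunM => //; exact: polyfun_cst.
Qed.

(** Homogenization is continuous and agrees with the quotient formula where [s] is nonzero, so it is
    the continuous extension. The direction [w], along which [s] grows at unit rate, makes the limit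
    unique. *)
Lemma scaledE (p : R -> R) (P : {poly R}) m (a s : V -> R) w :
  p =1 horner P -> (size P <= m.+1)%N -> polyfun a -> polyfun s ->
  (forall x h, s (h *: w + x) = h + s x) ->
  scaled p m a s = (fun x => (homogp m P (s x)).[a x]).
Proof.
move=> pP Pm pa ps sw; apply/funext => x; rewrite /scaled /cont_ext.
case: ifPn => [|]; rewrite ?inE ?notin_setE/= => sx.
  by rewrite horner_homogp// pP.
set D := [set _ | _].
(* From a zero of [s], a step [h] along [w] reaches a point where [s = h], so every neighbourhood
   meets [D]. *)
have PF : ProperFilter (within D (nbhs x)).
  apply: within_nbhs_proper => B Bx.
  have sx0 : s x = 0 by apply/eqP/negPn/negP.
  have cx : (fun h : R => h *: w + x) @ (0 : R) --> x.
    have : (fun h : R => h *: w + x) @ (0 : R) --> 0 *: w + x.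
      by apply: cvgD; [exact: scalel_continuous|exact: cvg_cst].
    by rewrite scale0r add0r.
  near (0 : R)^' => h.
  exists (h *: w + x); split.
    by rewrite /D /= sw sx0 addr0; near: h; exact: nbhs_dnbhs_neq.
  by near: h; apply: nbhs_dnbhs; exact: cx.
apply/cvg_lim => //.
set g := fun x => (homogp m P (s x)).[a x].
have cg : g @ within D (nbhs x) --> g x.
  apply: cvg_within_filter; apply: differentiable_continuous.
  by apply: polyfun_differentiable; exact: polyfun_homogp.
apply: cvg_trans cg; apply: near_eq_cvg; rewrite near_withinE.
by apply: nearW => y sy; rewrite /g horner_homogp// pP.
Unshelve. all: by end_near. Qed.

End PolynomialFunctions.

(** * Normal components of curls, and unit normals up to scaling *)

Section Curls.
Context {R : realType}.

Lemma sum_ord3 (V : nmodType) (F : 'I_3 -> V) : \sum_i F i = F 0 + F 1 + F 2.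
Proof.
rewrite !big_ord_recr big_ord0/= add0r.
by congr (F _ + F _ + F _); apply: val_inj.
Qed.

Lemma sum_ord2 (V : nmodType) (F : 'I_2 -> V) : \sum_i F i = F 0 + F 1.
Proof.
by rewrite !big_ord_recr big_ord0/= add0r; congr (F _ + F _); apply: val_inj.
Qed.

Lemma row3E (a b c : R) :
  (row3 a b c 0 0 = a) * (row3 a b c 0 1 = b) * (row3 a b c 0 2 = c).
Proof. by rewrite !mxE. Qed.

Lemma row2E (a b : R) : (row2 a b 0 0 = a) * (row2 a b 0 1 = b).
Proof. by rewrite !mxE. Qed.

Lemma dotDl d (u v w : 'rV[R]_d) : dot (u + v) w = dot u w + dot v w.
Proof. by rewrite -big_split; apply: eq_bigr => i _; rewrite mxE mulrDl. Qed.

Lemma dotZl d a (u w : 'rV[R]_d) : dot (a *: u) w = a * dot u w.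
Proof. by rewrite mulr_sumr; apply: eq_bigr => i _; rewrite mxE mulrA. Qed.

Lemma dotNl d (u w : 'rV[R]_d) : dot (- u) w = - dot u w.
Proof. by rewrite -scaleN1r dotZl mulN1r. Qed.

Lemma dotr0 d (u : 'rV[R]_d) : dot u 0 = 0.
Proof. by rewrite /dot big1// => i _; rewrite mxE mulr0. Qed.

Lemma dotC d (u v : 'rV[R]_d) : dot u v = dot v u.
Proof. by apply: eq_bigr => i _; rewrite mulrC. Qed.

Lemma dot_gt0 d (u : 'rV[R]_d) : u != 0 -> 0 < dot u u.
Proof.
move=> u0; have ge0 i : 0 <= u 0 i * u 0 i by rewrite -expr2 sqr_ge0.
rewrite lt_neqAle sumr_ge0// andbT eq_sym; apply: contra u0.
rewrite psumr_eq0// => /allP u0; apply/eqP/rowP => i; rewrite mxE; apply/eqP.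
by have := u0 i (mem_index_enum i); rewrite mulf_eq0 orbb.
Qed.

Lemma enorm_gt0 d (u : 'rV[R]_d) : u != 0 -> 0 < enorm u.
Proof. by move=> u0; rewrite sqrtr_gt0 dot_gt0. Qed.

Definition rot90 (u : 'rV[R]_2) : 'rV[R]_2 := row2 (u 0 1) (- u 0 0).

(** The scalar curl is the gradient turned by [rot90], which preserves the dot product. *)
Lemma dot_curl2 f x w : polyfun f -> dot (curl2 f x) (rot90 w) = 'D_w f x.
Proof.
move=> pf; rewrite -dot_grad// /dot !sum_ord2 !row2E !mxE; ring.
Qed.

(** The Binet-Cauchy identity. *)
Lemma dot_cross (u v b c : 'rV[R]_3) :
  dot (cross u v) (cross b c) = dot u b * dot v c - dot u c * dot v b.
Proof. by rewrite /dot !sum_ord3 !row3E; ring. Qed.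

(* The normal component of curl f on the plane spanned by b and c only
   involves tangential derivatives of tangential components of f. *)
Lemma dot_curl3 (f : 'rV[R]_3 -> 'rV[R]_3) x b c :
  (forall j, polyfun (fun y => f y 0 j)) ->
  dot (curl3 f x) (cross b c) =
  'D_b (fun y => dot (f y) c) x - 'D_c (fun y => dot (f y) b) x.
Proof.
move=> pf; rewrite -!dot_grad; [|exact: polyfun_dotl..].
have part i w : partial i (fun y => dot (f y) w) x =
    \sum_j partial i (fun y => f y 0 j) x * w 0 j.
  rewrite /partial.
  have -> : (fun y => dot (f y) w) = \sum_j (fun y => f y 0 j * w 0 j).
    by apply/funext => y; rewrite /dot fct_sumE.
  rewrite derive_sum; last first.
    by move=> j; apply: polyfun_derivable; apply: polyfunM => //; exact: polyfun_cst.
  apply: eq_bigr => j _; rewrite derive_polyfunM//; last exact: polyfun_cst.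
  by rewrite derive_cst mulr0 add0r mulrC.
rewrite /dot !sum_ord3 !row3E !mxE !part !sum_ord3; ring.
Qed.

Lemma forall_ord2 (P : 'I_2 -> Prop) : P 0 -> P 1 -> forall i, P i.
Proof.
move=> P0 P1 [[|[|//]]] i2.
  by rewrite (_ : Ordinal i2 = 0)//; exact: val_inj.
by rewrite (_ : Ordinal i2 = 1)//; exact: val_inj.
Qed.

Lemma forall_ord3 (P : 'I_3 -> Prop) : P 0 -> P 1 -> P 2 -> forall i, P i.
Proof.
move=> P0 P1 P2 [[|[|[|//]]]] i3.
- by rewrite (_ : Ordinal i3 = 0)//; exact: val_inj.
- by rewrite (_ : Ordinal i3 = 1)//; exact: val_inj.
- by rewrite (_ : Ordinal i3 = 2)//; exact: val_inj.
Qed.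

(** The last hypothesis makes [n] its own projection onto [N]; the factor is nonzero, as otherwise
    [n = 0] would have norm 1. *)
Lemma normal_scale d (n N : 'rV[R]_d) :
  N != 0 -> enorm n = 1 -> dot N N *: n = dot n N *: N ->
  exists2 k, k != 0 & n = k *: N.
Proof.
move=> N0 n1 nN; have N2 := lt0r_neq0 (dot_gt0 N0).
exists (dot n N / dot N N); last first.
  by rewrite mulrC -scalerA -nN scalerA mulVf// scale1r.
rewrite mulf_neq0 ?invr_neq0//; apply/eqP => nN0; move: n1.
have -> : n = 0 by apply: (scalerI N2); rewrite nN nN0 scale0r scaler0.
rewrite /enorm /dot big1 ?sqrtr0 => [/eqP|i _]; last by rewrite mxE mul0r.
by rewrite eq_sym oner_eq0.
Qed.

Lemma normal2E (b n : 'rV[R]_2) : rot90 b != 0 -> enorm n = 1 -> dot n b = 0 ->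
  exists2 k, k != 0 & n = k *: rot90 b.
Proof.
move=> N0 n1 nb; apply: normal_scale => //; apply/rowP => i; rewrite !mxE.
(* In the plane, [|N|^2 n - (n . N) N = (n . b) b] for [N = rot90 b], and [n . b = 0]. *)
apply/eqP; rewrite -subr_eq0 -(mulr0 (b 0 i)) -nb; apply/eqP; move: i.
by apply: forall_ord2; rewrite /dot !sum_ord2 !row2E/=; ring.
Qed.

Lemma normal3E (b c n : 'rV[R]_3) : cross b c != 0 -> enorm n = 1 ->
  dot n b = 0 -> dot n c = 0 -> exists2 k, k != 0 & n = k *: cross b c.
Proof.
move=> N0 n1 nb nc; apply: normal_scale => //; set N := cross b c.
(* Both sides are [N x (n x N)], expanded by the triple product rule outside or inside. *)
have : dot N N *: n - dot n N *: N = cross N (dot n c *: b - dot n b *: c).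
  apply/rowP; rewrite /cross; apply: forall_ord3;
    rewrite !mxE /dot !sum_ord3 !row3E/=; ring.
rewrite nb nc !scale0r subrr.
have -> : cross N 0 = 0.
  by apply/rowP; apply: forall_ord3; rewrite !mxE/= ?mxE !mulr0 subrr.
by move=> /eqP; rewrite subr_eq0 => /eqP.
Qed.

End Curls.

(** * Derivatives of polynomials in an affine argument *)

Section AffineComposition.
Context {R : realType}.

Lemma deriv_comp_affine (P : {poly R}) (a c : R) :
  (P \Po (a%:P * 'X + c%:P))^`().[0] = a * P^`().[c].
Proof.
rewrite deriv_comp derivD derivC addr0 derivM derivC derivX mul0r add0r mulr1.
by rewrite hornerM horner_comp !hornerE mulrC.
Qed.

Lemma horner_affine (a c x : R) : (a%:P * 'X + c%:P).[x] = a * x + c.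
Proof. by rewrite hornerD hornerM !hornerC hornerX. Qed.

Lemma deriv_affine (a c x : R) : (a%:P * 'X + c%:P)^`().[x] = a.
Proof.
by rewrite derivD derivC addr0 derivM derivC derivX mul0r add0r mulr1 hornerC.
Qed.

End AffineComposition.

(** * Normal traces on an edge *)

Section Edge.
Context {R : realType}.
Variables f1 f2 o : 'I_3.
Hypothesis Huniq : uniq [:: f1; f2; o].
Local Notation F := (f1, f2).
Local Notation l1 := (@lambda2 R f1).
Local Notation l2 := (@lambda2 R f2).
Local Notation A := (@vertex2 R f1).
Local Notation b := (@vertex2 R f2 - @vertex2 R f1).
Local Notation pt t := (A + t *: b).

Lemma polyfun_lambda2 i : polyfun (@lambda2 R i).
Proof.
have p0 : polyfun (fun x : 'rV[R]_2 => x 0 0) by exact: polyfun_coord.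
have p1 : polyfun (fun x : 'rV[R]_2 => x 0 1) by exact: polyfun_coord.
have ph (f : 'rV[R]_2 -> R) : polyfun f -> polyfun (fun x => f x / 2).
  by move=> pf; apply: polyfunM => //; exact: polyfun_cst.
case: i => [[|[|[|//]]]] i3; rewrite /lambda2/=.
- by apply: ph; do 2 apply: polyfunB => //; exact: polyfun_cst.
- by apply: ph; apply: polyfunB => //; apply: polyfunD => //; exact: polyfun_cst.
- exact: p1.
Qed.

Lemma lambda2_shift i j k h x :
  lambda2 i (h *: (@vertex2 R j - vertex2 k) + x) =
  lambda2 i x + h * ((i == j)%:R - (i == k)%:R).
Proof.
rewrite -!(@lambda2_vertex R).
by case: i => [[|[|[|//]]]] i3; rewrite /lambda2 !mxE/=; field.
Qed.

Lemma edge_lambda2 t : l1 (pt t) = 1 - t /\ l2 (pt t) = t.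
Proof.
move: Huniq; rewrite /= !inE !negb_or andbT => /andP[/andP[/negbTE n12 _] _].
rewrite addrC !lambda2_shift !lambda2_vertex !eqxx [f2 == f1]eq_sym n12/=.
by split; ring.
Qed.

Lemma edge_shift h t : h *: b + pt t = pt (t + h).
Proof. by rewrite addrCA -scalerDl addrC [h + t]addrC addrC. Qed.

Lemma edge_functionE m :
  scaled (int_jacobi m 0) m (fun x => l2 x - l1 x) (fun x => l2 x + l1 x) =
  (fun x => (homogp m (int_jacobip m 0) (l2 x + l1 x)).[l2 x - l1 x]).
Proof.
have pl := polyfun_lambda2.
(* Going from the opposite vertex to [A], [l1] grows at unit rate while [l2] is constant. *)
apply: (scaledE (w := A - vertex2 o)).
- by move=> x; rewrite int_jacobiE.
- by rewrite size_int_jacobip.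
- exact: polyfunB.
- exact: polyfunD.
move: Huniq; rewrite /= !inE !negb_or andbT => /andP[/andP[n12 n1o] n2o] x h.
rewrite !lambda2_shift eqxx [f2 == f1]eq_sym (negbTE n12) (negbTE n1o)
  (negbTE n2o)/=.
by ring.
Qed.

(** The value -1 is the constant trace of the lowest-order function; 2 is the chain-rule factor of
    [x = 2 t - 1]. *)
Definition edge_coef i : R := if i is 0%N then -1 else 2.

(** On the edge [l1 + l2 = 1], so homogenization is trivial and the trace is the derivative of an
    integrated Legendre polynomial. *)
Lemma trace_edge i t :
  dot (phi2 F i (pt t)) (rot90 b) = edge_coef i * (jacobi i 0).[2 * t - 1].
Proof.
have pl := polyfun_lambda2; have lt := edge_lambda2.
case: i => [|i].
  rewrite /phi2 dotDl dotNl !dotZl !dot_curl2//.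
  rewrite (@derive_line _ _ _ ((-1)%:P * 'X + (1 - t)%:P)); last first.
    by move=> h; rewrite edge_shift (lt _).1 horner_affine; ring.
  rewrite (@derive_line _ _ _ (1%:P * 'X + t%:P)); last first.
    by move=> h; rewrite edge_shift (lt _).2 horner_affine; ring.
  by rewrite !deriv_affine (lt _).1 (lt _).2 jacobi00 hornerC /edge_coef; ring.
rewrite /phi2 edge_functionE dot_curl2; last first.
  by apply: polyfun_homogp; [exact: polyfunB|exact: polyfunD].
rewrite (@derive_line _ _ _
  (int_jacobip i.+2 0 \Po (2%:P * 'X + (2 * t - 1)%:P))); last first.
  move=> h; rewrite edge_shift (lt _).1 (lt _).2 addrC subrK homogp_1 ?size_int_jacobip//.
  by rewrite horner_comp horner_affine; congr (_.[_]); ring.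
by rewrite deriv_comp_affine deriv_int_jacobip.
Qed.

End Edge.

(** * Normal traces on a face *)

Section Face.
Context {R : realType}.
Variables f1 f2 f3 o : 'I_4.
Hypothesis Huniq : uniq [:: f1; f2; f3; o].
Local Notation F := (f1, f2, f3).
Local Notation l1 := (@lambda3 R f1).
Local Notation l2 := (@lambda3 R f2).
Local Notation l3 := (@lambda3 R f3).
Local Notation A := (@vertex3 R f1).
Local Notation b := (@vertex3 R f2 - @vertex3 R f1).
Local Notation c := (@vertex3 R f3 - @vertex3 R f1).
Local Notation u := (@face_u R F).
Local Notation v := (@face_v R F).
Local Notation pt s t := (A + s *: b + t *: c).

Lemma polyfun_lambda3 i : polyfun (@lambda3 R i).
Proof.
have p0 : polyfun (fun x : 'rV[R]_3 => x 0 0) by exact: polyfun_coord.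
have p1 : polyfun (fun x : 'rV[R]_3 => x 0 1) by exact: polyfun_coord.
have p2 : polyfun (fun x : 'rV[R]_3 => x 0 2) by exact: polyfun_coord.
have ph (f : 'rV[R]_3 -> R) : polyfun f -> polyfun (fun x => f x / 2).
  by move=> pf; apply: polyfunM => //; exact: polyfun_cst.
case: i => [[|[|[|[|//]]]]] i3; rewrite /lambda3/=.
- by apply: ph; do 3 apply: polyfunB => //; exact: polyfun_cst.
- apply: ph; do 2 apply: polyfunB => //.
  by apply: polyfunD => //; exact: polyfun_cst.
- exact: p1.
- exact: p2.
Qed.

Lemma lambda3_shift i j k h x :
  lambda3 i (h *: (@vertex3 R j - vertex3 k) + x) =
  lambda3 i x + h * ((i == j)%:R - (i == k)%:R).
Proof.
rewrite -!(@lambda3_vertex R).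
by case: i => [[|[|[|[|//]]]]] i3; rewrite /lambda3 !mxE/=; field.
Qed.

Let neqs : (f1 == f2 = false) * (f1 == f3 = false) * (f1 == o = false) *
  (f2 == f1 = false) * (f2 == f3 = false) * (f2 == o = false) *
  (f3 == f1 = false) * (f3 == f2 = false) * (f3 == o = false).
Proof.
move: Huniq; rewrite /= !inE !negb_or !andbT.
case/andP => /and3P[/negbTE n12 /negbTE n13 /negbTE n1o].
case/andP => /andP[/negbTE n23 /negbTE n2o] /negbTE n3o.
by rewrite [f2 == f1]eq_sym [f3 == f1]eq_sym [f3 == f2]eq_sym.
Qed.

Lemma face_lambda3 s t :
  (l1 (pt s t) = 1 - s - t) * (l2 (pt s t) = s) * (l3 (pt s t) = t).
Proof.
rewrite addrC [_ + s *: b]addrC !lambda3_shift !lambda3_vertex !eqxx !neqs/=.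
by split; [split|]; ring.
Qed.

Lemma face_shift2 h s t : h *: b + pt s t = pt (s + h) t.
Proof.
rewrite [s + h]addrC scalerDl !addrA; congr (_ + _).
by rewrite addrAC addrC addrA.
Qed.

Lemma face_shift3 h s t : h *: c + pt s t = pt s (t + h).
Proof. by rewrite scalerDl addrC !addrA. Qed.

Let pl := polyfun_lambda3.

Let p12 : polyfun (fun x => l2 x + l1 x).
Proof. exact: polyfunD. Qed.

Let p12B : polyfun (fun x => l2 x - l1 x).
Proof. exact: polyfunB. Qed.

Let p123 : polyfun (fun x => l3 x + l2 x + l1 x).
Proof. by apply: polyfunD => //; exact: polyfunD. Qed.

Let p123B : polyfun (fun x => l3 x - l2 x - l1 x).
Proof. by apply: polyfunB => //; exact: polyfunB. Qed.

Lemma face_uE m : u m =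
  (fun x => (homogp m (int_jacobip m 0) (l2 x + l1 x)).[l2 x - l1 x]).
Proof.
(* This direction raises [l1] and keeps [l2]; for [face_v] the vertex off the face is used instead,
   so that [l3] is kept as well. *)
apply: (scaledE (w := A - vertex3 f3)) => //.
- by move=> x; rewrite int_jacobiE.
- by rewrite size_int_jacobip.
by move=> x h; rewrite !lambda3_shift eqxx !neqs/=; ring.
Qed.

Lemma face_vE i j : v i j =
  (fun x => (homogp j (int_jacobip j (2 * i).-1)
     (l3 x + l2 x + l1 x)).[l3 x - l2 x - l1 x]).
Proof.
apply: (scaledE (w := A - vertex3 o)) => //.
- by move=> x; rewrite int_jacobiE.
- by rewrite size_int_jacobip.
by move=> x h; rewrite !lambda3_shift eqxx !neqs/=; ring.
Qed.

Lemma face_u_pt m s t : u m (pt s t) =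
  (homogp m (int_jacobip m 0) (1 - t)).[2 * s - (1 - t)].
Proof.
by rewrite face_uE !face_lambda3; congr (homogp _ _ _).[_]; ring.
Qed.

(** On the face the three coordinates sum to 1, so [v] depends on [t] alone. *)
Lemma face_v_pt i j s t : v i j (pt s t) =
  (int_jacobip j (2 * i).-1).[2 * t - 1].
Proof.
rewrite face_vE !face_lambda3.
rewrite (_ : t + s + (1 - s - t) = 1) ?homogp_1 ?size_int_jacobip//; last by ring.
by congr (_.[_]); ring.
Qed.

Lemma polyfun_face_u m : polyfun (u m).
Proof. by rewrite face_uE; exact: polyfun_homogp. Qed.

Lemma polyfun_face_v i j : polyfun (v i j).
Proof. by rewrite face_vE; exact: polyfun_homogp. Qed.

Lemma derive_face_lambda3 (s t : R) :
  ('D_b l1 (pt s t) = -1) * ('D_b l2 (pt s t) = 1) * ('D_b l3 (pt s t) = 0) *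
  ('D_c l1 (pt s t) = -1) * ('D_c l2 (pt s t) = 0) * ('D_c l3 (pt s t) = 1).
Proof.
have E (w : 'rV[R]_3) f p q : (forall h, f (h *: w + pt s t) = p * h + q) ->
    'D_w f (pt s t) = p.
  move=> fpq; rewrite (@derive_line _ _ _ (p%:P * 'X + q%:P)) ?deriv_affine//.
  by move=> h; rewrite fpq horner_affine.
split; [split; [split; [split; [split|]|]|]|].
- by apply: (E _ _ _ (1 - s - t)) => h; rewrite face_shift2 !face_lambda3; ring.
- by apply: (E _ _ _ s) => h; rewrite face_shift2 !face_lambda3; ring.
- by apply: (E _ _ _ t) => h; rewrite face_shift2 !face_lambda3; ring.
- by apply: (E _ _ _ (1 - s - t)) => h; rewrite face_shift3 !face_lambda3; ring.
- by apply: (E _ _ _ s) => h; rewrite face_shift3 !face_lambda3; ring.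
- by apply: (E _ _ _ t) => h; rewrite face_shift3 !face_lambda3; ring.
Qed.

Lemma derive_face_u m s t : 'D_b (u m.+1) (pt s t) =
  2 * (homogp m (jacobi m 0) (1 - t)).[2 * s - (1 - t)].
Proof.
rewrite (@derive_line _ _ _ (homogp m.+1 (int_jacobip m.+1 0) (1 - t) \Po
  (2%:P * 'X + (2 * s - (1 - t))%:P))); last first.
  move=> h; rewrite face_shift2 face_u_pt horner_comp horner_affine.
  by congr (_.[_]); ring.
by rewrite deriv_comp_affine deriv_homogp deriv_int_jacobip.
Qed.

Lemma derive_face_v2 i j s t : 'D_b (v i j) (pt s t) = 0.
Proof.
rewrite (@derive_line _ _ _ (v i j (pt s t))%:P) ?derivC ?horner0//.
by move=> h; rewrite face_shift2 !face_v_pt hornerC.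
Qed.

Lemma derive_face_v3 i j s t : 'D_c (v i j.+1) (pt s t) =
  2 * (jacobi j (2 * i).-1).[2 * t - 1].
Proof.
rewrite (@derive_line _ _ _ (int_jacobip j.+1 (2 * i).-1 \Po
  (2%:P * 'X + (2 * t - 1)%:P))); last first.
  move=> h; rewrite face_shift3 face_v_pt horner_comp horner_affine.
  by congr (_.[_]); ring.
by rewrite deriv_comp_affine deriv_int_jacobip.
Qed.

Lemma polyfun_nedelec0 j : polyfun (fun x => @nedelec0 R F x 0 j).
Proof.
have -> : (fun x => @nedelec0 R F x 0 j) =
    (fun x => l2 x * partial j l1 x - l1 x * partial j l2 x).
  by apply/funext => x; rewrite !mxE.
by apply: polyfunB; apply: polyfunM => //; exact: polyfun_derive.
Qed.

Lemma polyfun_scale (f : 'rV[R]_3 -> R) (g : 'rV[R]_3 -> 'rV[R]_3) j :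
  polyfun f -> polyfun (fun x => g x 0 j) ->
  polyfun (fun x => (f x *: g x) 0 j).
Proof.
move=> pf pg; have -> : (fun x => (f x *: g x) 0 j) = (fun x => f x * g x 0 j).
  by apply/funext => x; rewrite mxE.
exact: polyfunM.
Qed.

Lemma dot_nedelec0 x w :
  dot (@nedelec0 R F x) w = l2 x * 'D_w l1 x - l1 x * 'D_w l2 x.
Proof. by rewrite /nedelec0 dotDl dotNl !dotZl !dot_grad. Qed.

Lemma trace_face0 j s t : dot (phi3 F 0 j (pt s t)) (cross b c) =
  (face_poly 0 j).[2 * t - 1].
Proof.
case: j => [|j].
  (* By Binet-Cauchy each cross product of gradients contributes 1, leaving [l1 + l2 + l3 = 1]. *)
  rewrite hornerC /phi3 !dotDl !dotZl !dot_cross !dot_grad//.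
  by rewrite !derive_face_lambda3 !face_lambda3; ring.
rewrite /phi3 dot_curl3; last first.
  by move=> i; apply: polyfun_scale; [exact: polyfun_face_v|exact: polyfun_nedelec0].
set V := v 2 j.+1 (pt s t); set P : {poly R} := int_jacobip j.+1 3.
have VE : V = P.[2 * t - 1] by exact: face_v_pt.
(* On the face the component of [nedelec0] along [c] is [- s] and that along [b] is [t - 1]. The
   trace is therefore [- V - (2 (t - 1) P' + V)], that is [(1 - x) P' - 2 P] at [x = 2 t - 1]. *)
rewrite (@derive_line _ _ _ ((- V)%:P * 'X + (- V * s)%:P)); last first.
  move=> h; rewrite face_shift2 dotZl dot_nedelec0 !derive_face_lambda3.
  by rewrite !face_lambda3 face_v_pt horner_affine VE; ring.
rewrite (@derive_line _ _ _ ((P \Po (2%:P * 'X + (2 * t - 1)%:P)) *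
  (1%:P * 'X + (t - 1)%:P))); last first.
  move=> h; rewrite face_shift3 dotZl dot_nedelec0 !derive_face_lambda3.
  rewrite !face_lambda3 face_v_pt hornerM horner_comp !horner_affine.
  rewrite (_ : 2 * (t + h) - 1 = 2 * h + (2 * t - 1)); last by ring.
  by rewrite -/P; ring.
rewrite deriv_affine derivM hornerD !hornerM deriv_comp_affine deriv_affine.
rewrite horner_comp !horner_affine deriv_int_jacobip !mulr0 !add0r -VE.
rewrite /face_poly hornerD hornerN !hornerM hornerD hornerN !hornerC hornerX -VE.
by ring.
Qed.

Lemma trace_faceS i j s t : dot (phi3 F i.+1 j (pt s t)) (cross b c) =
  (homogp i.+1 (jacobi i.+1 0) (1 - t)).[2 * s - (1 - t)] *
  (face_poly i.+1 j).[2 * t - 1].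
Proof.
have pu := polyfun_face_u i.+2; have pv := polyfun_face_v i.+2 j.+1.
have pDu w : polyfun ('D_w (u i.+2)) by exact: polyfun_derive.
rewrite /phi3 dot_curl3; last first.
  move=> k; apply: polyfun_scale => //.
  have -> : (fun x => grad (u i.+2) x 0 k) = partial k (u i.+2).
    by apply/funext => x; rewrite mxE.
  exact: polyfun_derive.
have dotE w : (fun y => dot (v i.+2 j.+1 y *: grad (u i.+2) y) w) =
    (fun y => v i.+2 j.+1 y * 'D_w (u i.+2) y).
  by apply/funext => y; rewrite dotZl dot_grad.
rewrite (dotE c) (dotE b).
have Db := derive_polyfunM (pt s t) b pv (pDu c).
have Dc := derive_polyfunM (pt s t) c pv (pDu b).
(* The second derivatives of [u] now cancel. As [v] is constant along [b], only [- 'D_c v * 'D_b u]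
   is left, with coefficient [- 2 * 2 = -4]. *)
rewrite (derive_comm c b (pt s t) pu) in Dc.
apply: (etrans (congr2 (fun x y => x - y) Db Dc)).
rewrite derive_face_v2 derive_face_v3 derive_face_u.
rewrite /face_poly hornerM hornerN hornerC.
rewrite (_ : (2 * i.+2).-1 = (2 * i.+1).+1); last lia.
by ring.
Qed.

Lemma trace_face i j s t : dot (phi3 F i j (pt s t)) (cross b c) =
  (homogp i (jacobi i 0) (1 - t)).[2 * s - (1 - t)] *
  (face_poly i j).[2 * t - 1].
Proof.
case: i => [|i]; last exact: trace_faceS.
have h1 : homogp 0 1 (1 - t) = 1.
  by apply/polyP => -[|r]; rewrite coef_poly !coef1 ?mul1r.
by rewrite trace_face0 jacobi00 h1 hornerC mul1r.
Qed.

End Face.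

(** * Assembly of the inner products on edges and faces *)

Section Assembly.
Context {R : realType}.
Local Notation mu := (@lebesgue_measure R).

Lemma edge_opposite (F : 'I_3 * 'I_3) : F \in edges ->
  exists o, uniq [:: F.1; F.2; o].
Proof.
rewrite !inE => /or3P[] /eqP ->; [by exists 2|by exists 0|by exists 1].
Qed.

Lemma face_opposite (F : 'I_4 * 'I_4 * 'I_4) : F \in faces ->
  exists o, uniq [:: F.1.1; F.1.2; F.2; o].
Proof.
rewrite !inE => /or4P[] /eqP ->; [by exists 3|by exists 1|by exists 2|by exists 0].
Qed.

Lemma L2_edge_trace (F : 'I_3 * 'I_3) (n : 'rV[R]_2) i j :
  F \in edges -> unit_normal2 F n ->
  exists2 c, 0 < c &
    L2_edge F (fun x => dot (phi2 F i x) n) (fun x => dot (phi2 F j x) n)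
    = c * (i == j)%:R.
Proof.
case: F => f1 f2 /edge_opposite[f3 Huniq] [n1 nb].
set b := vertex2 f2 - vertex2 f1 in nb.
have tr := @trace_edge R f1 f2 f3 Huniq.
(* A zero vector here would annihilate the lowest-order trace, which is -1. *)
have rot0 : rot90 b != 0.
  apply/eqP => b0; have := tr 0%N 0; rewrite jacobi00 hornerC mulr1 -/b b0 dotr0.
  by move/eqP; rewrite eq_sym oppr_eq0 oner_eq0.
have b_gt0 : 0 < enorm b.
  apply: enorm_gt0; apply: contra rot0 => /eqP ->; apply/eqP/rowP.
  by apply: forall_ord2; rewrite !mxE ?oppr0.
have [k k0 nE] := normal2E rot0 n1 nb.
have [c c0 E] := @legendre_orthogonal R i j.
have ne0 l : @edge_coef R l != 0.
  by case: l => [|l]; rewrite /= ?oppr_eq0 ?oner_eq0 ?pnatr_eq0.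
have L : L2_edge (f1, f2) (fun x => dot (phi2 (f1, f2) i x) n)
    (fun x => dot (phi2 (f1, f2) j x) n) =
    enorm b * (k ^+ 2 * (edge_coef i * edge_coef j) * (c * (i == j)%:R) / 2).
  rewrite /L2_edge -/b; congr (_ * _); rewrite -E.
  pose Q : {poly R} :=
    (k ^+ 2 * (edge_coef i * edge_coef j)) *: (jacobi i 0 * jacobi j 0).
  transitivity (\int[mu]_(t in `[0, 1]) ((1 - t) ^+ 0 * Q.[2 * t - 1])).
    apply: eq_Rintegral => t _.
    rewrite [dot _ n]dotC [X in _ * X]dotC nE !dotZl ![dot (rot90 b) _]dotC !tr.
    by rewrite /Q [(_ *: (_ * _)).[_]]hornerZ hornerM; ring.
  by rewrite Rintegral_weighted mul1r expr1 /Q defintZ.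
(* The computed factor can be negative for [i != j], where the [edge_coef] may differ in sign; both
   sides being zero, 1 is taken. On the diagonal only squares occur. *)
rewrite L; have [<-|ij] := eqVneq i j; last by exists 1 => //; rewrite !(mulr0, mul0r).
exists (enorm b * (k ^+ 2 * (edge_coef i * edge_coef i) * c / 2)); last by ring.
rewrite mulr_gt0// divr_gt0// mulr_gt0// -expr2 mulr_gt0//.
  by rewrite exprn_even_gt0.
by rewrite exprn_even_gt0/=.
Qed.

(** The two requirements of [Rintegral_triangle], carried together through ring operations. *)
Definition contmeas (f : R * R -> R) := continuous f /\ measurable_fun setT f.

Lemma contmeasD f g : contmeas f -> contmeas g -> contmeas (fun z => f z + g z).
Proof.
move=> [cf mf] [cg mg]; split; last exact: measurable_funD.
by move=> z; apply: cvgD; [exact: cf|exact: cg].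
Qed.

Lemma contmeasM f g : contmeas f -> contmeas g -> contmeas (fun z => f z * g z).
Proof.
move=> [cf mf] [cg mg]; split; last exact: measurable_funM.
by move=> z; apply: cvgM; [exact: cf|exact: cg].
Qed.

Lemma contmeas_cst a : contmeas (fun=> a).
Proof. by split => [z|]; [exact: cvg_cst|exact: measurable_cst]. Qed.

Lemma contmeasX f n : contmeas f -> contmeas (fun z => f z ^+ n).
Proof.
move=> nf; elim: n => [|n IHn]; first exact: contmeas_cst.
have -> : (fun z => f z ^+ n.+1) = (fun z => f z * f z ^+ n).
  by apply/funext => z; rewrite exprS.
exact: contmeasM.
Qed.

Lemma contmeas_sum n (f : 'I_n -> R * R -> R) :
  (forall i, contmeas (f i)) -> contmeas (fun z => \sum_i f i z).
Proof.
elim: n f => [|n IHn] f nf.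
  have -> : (fun z => \sum_i f i z) = (fun=> 0).
    by apply/funext => z; rewrite big_ord0.
  exact: contmeas_cst.
have -> : (fun z => \sum_i f i z) =
          (fun z => f ord0 z + \sum_(i < n) f (lift ord0 i) z).
  by apply/funext => z; rewrite big_ord_recl.
by apply: contmeasD => //; apply: IHn.
Qed.

Lemma contmeas_homogp m (P : {poly R}) a s :
  contmeas a -> contmeas s -> contmeas (fun z => (homogp m P (s z)).[a z]).
Proof.
move=> na ns.
have -> : (fun z => (homogp m P (s z)).[a z]) =
    (fun z => \sum_(r < m.+1) P`_r * s z ^+ (m - r) * a z ^+ r).
  by apply/funext => z; rewrite horner_poly.
apply: contmeas_sum => r; apply: contmeasM; last exact: contmeasX.
by apply: contmeasM; [exact: contmeas_cst|exact: contmeasX].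
Qed.

Lemma contmeas_fst : contmeas fst.
Proof. by split => [z|]; [exact: cvg_fst|exact: measurable_fst]. Qed.

Lemma contmeas_snd : contmeas snd.
Proof. by split => [z|]; [exact: cvg_snd|exact: measurable_snd]. Qed.

Lemma Rintegral_triangle_homogp i l (p q Q : {poly R}) :
  (size p <= i.+1)%N -> (size q <= l.+1)%N ->
  \int[(mu \x mu)%E]_(z in triangle)
    ((homogp i p (1 - z.2)).[2 * z.1 - (1 - z.2)] *
     (homogp l q (1 - z.2)).[2 * z.1 - (1 - z.2)] * Q.[2 * z.2 - 1]) =
  defint (p * q) / 2 * (defint ((1 - 'X) ^+ (i + l).+1 * Q) / 2 ^+ (i + l).+2).
Proof.
move=> pi ql.
have n1 : contmeas (fun z => 1 - z.2).
  apply: contmeasD; first exact: contmeas_cst.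
  have -> : (fun z : R * R => - z.2) = (fun z => -1 * z.2).
    by apply/funext => z; rewrite mulN1r.
  by apply: contmeasM; [exact: contmeas_cst|exact: contmeas_snd].
have n2 : contmeas (fun z => 2 * z.1 - (1 - z.2)).
  have -> : (fun z : R * R => 2 * z.1 - (1 - z.2)) =
      (fun z => 2 * z.1 + (-1 + z.2)).
    by apply/funext => z; ring.
  apply: contmeasD.
    by apply: contmeasM; [exact: contmeas_cst|exact: contmeas_fst].
  by apply: contmeasD; [exact: contmeas_cst|exact: contmeas_snd].
have n3 : contmeas (fun z => Q.[2 * z.2 - 1]).
  have -> : (fun z : R * R => Q.[2 * z.2 - 1]) =
      (fun z => (homogp (size Q) Q 1).[2 * z.2 + -1]).
    by apply/funext => z; rewrite homogp_1.
  apply: contmeas_homogp; last exact: contmeas_cst.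
  apply: contmeasD; last exact: contmeas_cst.
  by apply: contmeasM; [exact: contmeas_cst|exact: contmeas_snd].
have [cf mf] := contmeasM
  (contmeasM (contmeas_homogp i p n2 n1) (contmeas_homogp l q n2 n1)) n3.
rewrite Rintegral_triangle//=.
pose C := defint (p * q) / 2.
transitivity (\int[mu]_(t in `[0, 1])
  ((1 - t) ^+ (i + l).+1 * (C *: Q).[2 * t - 1])).
  apply: eq_Rintegral => t; rewrite inE/= in_itv/= => /andP[t0 t1].
  (* For fixed [t] the value of [Q] is a constant, absorbed into [p] to match [Rintegral_homogp]. *)
  transitivity (\int[mu]_(s in `[0, 1 - t])
     ((homogp i (Q.[2 * t - 1] *: p) (1 - t)).[2 * s - (1 - t)] *
     (homogp l q (1 - t)).[2 * s - (1 - t)])).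
    by apply: eq_Rintegral => s _; rewrite homogpZ hornerZ; ring.
  rewrite Rintegral_homogp ?subr_ge0//; last by rewrite (leq_trans (size_scale_leq _ _)).
  by rewrite -scalerAl defintZ hornerZ /C; ring.
by rewrite Rintegral_weighted -scalerAr defintZ mulrA.
Qed.

Lemma L2_face_trace (F : 'I_4 * 'I_4 * 'I_4) (n : 'rV[R]_3) i j l m :
  F \in faces -> unit_normal3 F n ->
  exists2 c, 0 < c &
    L2_face F (fun x => dot (phi3 F i j x) n) (fun x => dot (phi3 F l m x) n)
    = c * (i == l)%:R * (j == m)%:R.
Proof.
case: F => -[f1 f2] f3 /face_opposite[f4 Huniq] [n1 nb nc].
set b := vertex3 f2 - vertex3 f1 in nb; set c := vertex3 f3 - vertex3 f1 in nc.
have tr := @trace_face R f1 f2 f3 f4 Huniq; rewrite -/b -/c in tr.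
have N0 : cross b c != 0.
  apply/eqP => N0; have := @trace_face0 R f1 f2 f3 f4 Huniq 0%N 0 0.
  rewrite hornerC -/b -/c N0 dotr0.
  by move/eqP; rewrite eq_sym oner_eq0.
have [k k0 nE] := normal3E N0 n1 nb nc.
have [c1 c10 E1] := @legendre_orthogonal R i l.
have L : L2_face (f1, f2, f3) (fun x => dot (phi3 (f1, f2, f3) i j x) n)
    (fun x => dot (phi3 (f1, f2, f3) l m x) n) =
    enorm (cross b c) * (c1 * (i == l)%:R / 2 * (k ^+ 2 *
      defint ((1 - 'X) ^+ (i + l).+1 * (face_poly i j * face_poly l m)) /
        2 ^+ (i + l).+2)).
  rewrite /L2_face -/b -/c -E1; congr (_ * _).
  transitivity (\int[(mu \x mu)%E]_(z in triangle)
    ((homogp i (jacobi i 0) (1 - z.2)).[2 * z.1 - (1 - z.2)] *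
     (homogp l (jacobi l 0) (1 - z.2)).[2 * z.1 - (1 - z.2)] *
     (k ^+ 2 *: (face_poly i j * face_poly l m)).[2 * z.2 - 1])).
    apply: eq_Rintegral => z _.
    rewrite [dot _ n]dotC [X in _ * X]dotC nE !dotZl ![dot (cross b c) _]dotC !tr.
    by rewrite [(_ *: (_ * _)).[_]]hornerZ hornerM; ring.
  rewrite Rintegral_triangle_homogp ?size_jacobi//.
  by rewrite -[_ ^+ _ * (_ *: _)]scalerAr defintZ.
rewrite L; have [il|il] := eqVneq i l; last by exists 1 => //; rewrite !(mulr0, mul0r).
have [c2 c20 E2] := @face_poly_norm R i j m.
(* For [i = l] the exponent [i + l + 1] is [2 i + 1], the weight for which [face_poly i] is an
   orthogonal family. *)
rewrite -il addnn -mul2n; move: E2; rewrite -mulrA => ->.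
exists (enorm (cross b c) * (c1 / 2 * (k ^+ 2 * c2 / 2 ^+ (2 * i).+2))); last by ring.
rewrite mulr_gt0 ?enorm_gt0// mulr_gt0 ?divr_gt0// ?exprn_gt0// mulr_gt0//.
by rewrite exprn_even_gt0.
Qed.

End Assembly.

Theorem lemma3p1 (R : realType) (k : nat) (k_ge1 : (1 <= k)%N) :
  (forall (F : 'I_3 * 'I_3) (n : 'rV[R]_2),
      F \in edges -> unit_normal2 F n ->
      forall i j : nat, (i <= k)%N -> (j <= k)%N ->
      exists2 c : R, 0 < c &
        L2_edge F (fun x => dot (phi2 F i x) n) (fun x => dot (phi2 F j x) n)
        = c * (i == j)%:R)
  /\
  (forall (F : 'I_4 * 'I_4 * 'I_4) (n : 'rV[R]_3),
      F \in faces -> unit_normal3 F n ->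
      forall i j l m : nat, (i + j <= k)%N -> (l + m <= k)%N ->
      exists2 c : R, 0 < c &
        L2_face F (fun x => dot (phi3 F i j x) n) (fun x => dot (phi3 F l m x) n)
        = c * (i == l)%:R * (j == m)%:R).
Proof.
split=> [F n FE nF i j _ _|F n FF nF i j l m _ _]; first exact: L2_edge_trace.
exact: L2_face_trace.
Qed.
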